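(* If there exists a $\sigma$-approximation algorithm for the closest substring problem, then there exists an approximation algorithm for Reopt-CSP$_{\mathcal{M}_{l+1}}$ which, on input $\mathcal{S}$ and an optimal $l$-length closest substring $v_{opt}$, outputs an $(l+1)$-length string $v'_{sol}$ with $$\mathrm{cost}(v'_{sol})\le \frac{2\sigma-1}{\sigma}\,\mathrm{cost}(v'_{opt})+\frac{\sigma-1}{\sigma}(t-1),$$ where $v'_{opt}$ is an optimal $(l+1)$-length closest substring of $\mathcal{S}$.
   Context: For strings $u,w$ of equal length, $d(u,w)$ is the Hamming distance. Let $\mathcal{S}=\{S_1,\dots,S_t\}$ be sequences over a finite alphabet $\Sigma$, each of length $n$. For $v\in\Sigma^m$, $\mathrm{cost}(v)=\sum_{i=1}^t\min\{d(v,y): y\text{ an } m\text{-length substring of } S_i\}$; an optimal $m$-length closest substring minimizes this over $\Sigma^m$. The closest substring problem (CSP): given $\mathcal{S}$ and $m$, find $v\in\Sigma^m$ minimizing $\mathrm{cost}(v)$. A $\sigma$-approximation algorithm for CSP ($\sigma\ge1$) outputs $v\in\Sigma^m$ with $\mathrm{cost}(v)\le\sigma$ times the optimum. Reopt-CSP$_{\mathcal{M}_{l+1}}$: given $\mathcal{S}$ and an optimal $l$-length closest substring $v_{opt}$ of $\mathcal{S}$, find an $(l+1)$-length closest substring. *)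

(* Defs.v *)
From mathcomp Require Import all_boot all_order all_algebra.
From mathcomp Require Import reals.

Set Implicit Arguments.
Unset Strict Implicit.
Unset Printing Implicit Defensive.

Import Order.TTheory GRing.Theory Num.Theory.

Section ClosestSubstring.
Variable Sigma : finType.

Definition hamming (m : nat) (u w : m.-tuple Sigma) : nat :=
  #|[set i : 'I_m | tnth u i != tnth w i]|.

(* [infix] is contiguous containment.  Hamming distances between strings of
   length m are at most m, so the default value m does not affect the minimum
   as soon as s has a substring of length m, i.e. m <= n. *)
Definition dist_to_substrings (m n : nat) (v : m.-tuple Sigma)
    (s : n.-tuple Sigma) : nat :=
  \big[minn/m]_(y : m.-tuple Sigma | infix y s) hamming v y.

Definition cost (t n m : nat) (Ss : t.-tuple (n.-tuple Sigma))
    (v : m.-tuple Sigma) : nat :=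
  (\sum_(i < t) dist_to_substrings v (tnth Ss i))%N.

Definition optimal_closest_substring (t n m : nat)
    (Ss : t.-tuple (n.-tuple Sigma)) (v : m.-tuple Sigma) : Prop :=
  forall w : m.-tuple Sigma, (cost Ss v <= cost Ss w)%N.

End ClosestSubstring.

(* An approximation algorithm is a polynomial-time algorithm: without a time
   bound, exhaustive search would always be one.  The model of computation is
   the WHILE language over binary trees of N. D. Jones (Computability and
   Complexity from a Programming Perspective), whose polynomial-time functions
   are the usual ones.  Expressions are charged one unit per syntax node;
   there is no unit-cost equality test on trees. *)

Inductive tree : Type := Nil | Cons of tree & tree.

Fixpoint tree_size (x : tree) : nat :=
  if x is Cons a b then (tree_size a + tree_size b).+1 else 1.

Definition tree_hd (x : tree) : tree := if x is Cons a _ then a else Nil.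
Definition tree_tl (x : tree) : tree := if x is Cons _ b then b else Nil.

Inductive expr : Type :=
  | EVar of nat
  | ENil
  | ECons of expr & expr
  | EHd of expr
  | ETl of expr.

Inductive cmd : Type :=
  | Skip
  | Assign of nat & expr
  | Seq of cmd & cmd
  | If of expr & cmd & cmd
  | While of expr & cmd.

Definition store : Type := nat -> tree.

Definition update (st : store) (x : nat) (v : tree) : store :=
  fun y => if y == x then v else st y.

Fixpoint eval (st : store) (e : expr) : tree :=
  match e with
  | EVar x => st x
  | ENil => Nil
  | ECons e1 e2 => Cons (eval st e1) (eval st e2)
  | EHd e1 => tree_hd (eval st e1)
  | ETl e1 => tree_tl (eval st e1)
  end.

Fixpoint eval_time (e : expr) : nat :=
  match e with
  | EVar _ | ENil => 1
  | ECons e1 e2 => (eval_time e1 + eval_time e2).+1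
  | EHd e1 | ETl e1 => (eval_time e1).+1
  end.

(* [exec c st k st']: started in store st, the command c halts after exactly
   k time units in store st'.  As a truth value, Nil is false and every other
   tree is true. *)
Inductive exec : cmd -> store -> nat -> store -> Prop :=
  | ExecSkip st : exec Skip st 1 st
  | ExecAssign st x e :
      exec (Assign x e) st (eval_time e).+1 (update st x (eval st e))
  | ExecSeq st1 st2 st3 c1 c2 k1 k2 :
      exec c1 st1 k1 st2 -> exec c2 st2 k2 st3 ->
      exec (Seq c1 c2) st1 (k1 + k2).+1 st3
  | ExecIfTrue st st' e c1 c2 k :
      eval st e <> Nil -> exec c1 st k st' ->
      exec (If e c1 c2) st (eval_time e + k).+1 st'
  | ExecIfFalse st st' e c1 c2 k :
      eval st e = Nil -> exec c2 st k st' ->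
      exec (If e c1 c2) st (eval_time e + k).+1 st'
  | ExecWhileTrue st1 st2 st3 e c k1 k2 :
      eval st1 e <> Nil -> exec c st1 k1 st2 ->
      exec (While e c) st2 k2 st3 ->
      exec (While e c) st1 (eval_time e + k1 + k2).+1 st3
  | ExecWhileFalse st e c :
      eval st e = Nil -> exec (While e c) st (eval_time e).+1 st.

(* Variable 0 holds the input at the start and the output at the end; all
   other variables initially hold Nil. *)
Definition init_store (x : tree) : store := update (fun=> Nil) 0 x.

Definition runs_in (p : cmd) (x : tree) (k : nat) (y : tree) : Prop :=
  exists2 st, exec p (init_store x) k st & st 0 = y.

Definition outputs (p : cmd) (x y : tree) : Prop := exists k, runs_in p x k y.

Definition poly_time_on (dom : tree -> Prop) (p : cmd) : Prop :=
  exists c d : nat, forall x, dom x ->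
    exists k y, runs_in p x k y /\ (k <= c * tree_size x ^ d)%N.

Section Encodings.
Variable Sigma : finType.

Definition enc_nat (n : nat) : tree := iter n (Cons Nil) Nil.

Definition enc_seq (T : Type) (enc : T -> tree) (s : seq T) : tree :=
  foldr (fun a => Cons (enc a)) Nil s.

Definition enc_symbol (a : Sigma) : tree := enc_nat (enum_rank a).

Definition enc_string (s : seq Sigma) : tree := enc_seq enc_symbol s.

Definition enc_family (t n : nat) (Ss : t.-tuple (n.-tuple Sigma)) : tree :=
  enc_seq (fun s : n.-tuple Sigma => enc_string s) Ss.

Definition csp_input (t n : nat) (Ss : t.-tuple (n.-tuple Sigma)) (m : nat) :
    tree :=
  Cons (enc_family Ss) (enc_nat m).

Definition is_csp_input (x : tree) : Prop :=
  exists (t n m : nat) (Ss : t.-tuple (n.-tuple Sigma)),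
    [/\ (0 < t)%N, (m <= n)%N & x = csp_input Ss m].

Definition reopt_input (t n l : nat) (Ss : t.-tuple (n.-tuple Sigma))
    (vopt : l.-tuple Sigma) : tree :=
  Cons (enc_family Ss) (enc_string vopt).

Definition is_reopt_input (x : tree) : Prop :=
  exists (t n l : nat) (Ss : t.-tuple (n.-tuple Sigma)) (vopt : l.-tuple Sigma),
    [/\ (0 < t)%N, (l.+1 <= n)%N, optimal_closest_substring Ss vopt
      & x = reopt_input Ss vopt].

End Encodings.

Definition csp_approx_algorithm (R : realType) (Sigma : finType) (sigma : R)
    (p : cmd) : Prop :=
  poly_time_on (@is_csp_input Sigma) p /\
  forall (t n m : nat) (Ss : t.-tuple (n.-tuple Sigma)),
    (0 < t)%N -> (m <= n)%N ->
    exists v : m.-tuple Sigma,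
      outputs p (csp_input Ss m) (enc_string v) /\
      forall vopt : m.-tuple Sigma, optimal_closest_substring Ss vopt ->
        ((cost Ss v)%:R <= sigma * (cost Ss vopt)%:R :> R)%R.

(* Main.v *)
Require Import Defs.
From mathcomp Require Import all_boot all_order all_algebra.
From mathcomp Require Import boolp reals zify ring lra.

(* A CSP algorithm of ratio rho solves the reoptimization problem with ratio
   rho: from the given optimal string only its length l is kept, and the
   algorithm is run with the length l + 1.  Hence it suffices to have an
   algorithm of ratio (2 sigma - 1) / sigma = 1 + (sigma - 1) / sigma.  For
   sigma = 1 this is the given one.  For sigma > 1 there is one without any
   hypothesis, since CSP has a polynomial-time approximation scheme, due to Li,
   Ma and Wang.  Let y_1, ..., y_t be the substrings closest to an optimal
   string; the columnwise plurality of r of the y_i, drawn independently and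
   uniformly, has expected cost at most 1 + O(|Sigma| / sqrt r) times the
   optimum (Chebyshev's inequality in every column).  For a constant r all
   r-tuples of substrings of the family can be tried in polynomial time.  The
   search tries all r-tuples of suffixes instead, which is the same because only
   the first columns are read. *)

Set Implicit Arguments.
Unset Strict Implicit.
Unset Printing Implicit Defensive.

Import Order.TTheory GRing.Theory Num.Theory.
(* Makes [Nil] and [Cons] denote the tree constructors again, not those of
   seq. *)
Import Defs.

(** * Polynomials with natural coefficients *)

Inductive is_polynomial : (nat -> nat) -> Prop :=
  | is_polynomial_const c : is_polynomial (fun=> c)
  | is_polynomial_id : is_polynomial (fun n => n)
  | is_polynomialD f g :
      is_polynomial f -> is_polynomial g -> is_polynomial (fun n => f n + g n)
  | is_polynomialM f g :
      is_polynomial f -> is_polynomial g -> is_polynomial (fun n => f n * g n).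

Lemma is_polynomial_homo f : is_polynomial f -> {homo f : m n / m <= n}.
Proof.
move=> pf m n mn; elim: pf => // g h _ IHg _ IHh; first exact: leq_add.
exact: leq_mul.
Qed.

Lemma is_polynomial_comp f g :
  is_polynomial f -> is_polynomial g -> is_polynomial (fun n => f (g n)).
Proof.
move=> pf pg; elim: pf => [c||f1 f2 _ ? _ ?|f1 f2 _ ? _ ?] //.
- exact: is_polynomial_const.
- exact: is_polynomialD.
- exact: is_polynomialM.
Qed.

Lemma is_polynomialS f : is_polynomial f -> is_polynomial (fun n => (f n).+1).
Proof. exact: is_polynomialD (is_polynomial_const 1). Qed.

Lemma is_polynomialX f d : is_polynomial f -> is_polynomial (fun n => f n ^ d).
Proof.
move=> pf; elim: d => [|d IHd]; first exact: is_polynomial_const.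
rewrite (_ : (fun n => _) = (fun n => f n * f n ^ d)).
  exact: is_polynomialM.
by apply: funext => n; rewrite expnS.
Qed.

Lemma is_polynomial_le_monomial f : is_polynomial f ->
  exists c d : nat, forall n, 0 < n -> f n <= c * n ^ d.
Proof.
elim=> [c||f1 f2 _ [c1 [d1 le1]] _ [c2 [d2 le2]]|
        f1 f2 _ [c1 [d1 le1]] _ [c2 [d2 le2]]].
- by exists c, 0 => n _; rewrite expn0 muln1.
- by exists 1, 1 => n _; rewrite expn1 mul1n.
- exists (c1 + c2), (d1 + d2) => n n_gt0; rewrite mulnDl leq_add //.
  + rewrite (leq_trans (le1 _ n_gt0)) // leq_mul2l.
    by rewrite leq_pexp2l ?leq_addr ?orbT.
  + rewrite (leq_trans (le2 _ n_gt0)) // leq_mul2l.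
    by rewrite leq_pexp2l ?leq_addl ?orbT.
- exists (c1 * c2), (d1 + d2) => n n_gt0.
  by rewrite expnD mulnACA leq_mul ?le1 ?le2.
Qed.

Create HintDb polynomial.
#[local] Hint Resolve is_polynomial_const is_polynomial_id is_polynomialD
  is_polynomialM is_polynomialS : polynomial.

Ltac solve_polynomial := auto 20 with polynomial.

(** * Polynomial-time functions on trees *)

Lemma tree_size_gt0 x : 0 < tree_size x.
Proof. by case: x. Qed.

Lemma tree_size_hd x : tree_size (tree_hd x) <= tree_size x.
Proof. by case: x => //= a b; rewrite ltnW // ltnS leq_addr. Qed.

Lemma tree_size_tl x : tree_size (tree_tl x) <= tree_size x.
Proof. by case: x => //= a b; rewrite ltnW // ltnS leq_addl. Qed.

Lemma update_same st x v : update st x v x = v.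
Proof. by rewrite /update eqxx. Qed.

Lemma update_other st x v y : y != x -> update st x v y = st y.
Proof. by rewrite /update => /negbTE->. Qed.

(* The program [c b] reads its argument from and leaves its result in variable
   b, using the variables above b as scratch space of arbitrary initial
   content. *)
Definition computes (c : nat -> cmd) (f : tree -> tree) (T : nat -> nat) :
    Prop :=
  forall b st, exists k st',
    [/\ exec (c b) st k st', st' b = f (st b), forall x, x < b -> st' x = st x
      & k <= T (tree_size (st b))].

Definition poly_size (f : tree -> tree) : Prop :=
  exists2 S, is_polynomial S & forall x, tree_size (f x) <= S (tree_size x).

(* The size of the result has to be bounded separately, since the trees of a
   store can share subtrees: k steps can build a tree of size 2^k. *)
Definition polytime (f : tree -> tree) : Prop :=
  poly_size f /\ exists c T, is_polynomial T /\ computes c f T.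

Lemma polytime_assign (e : nat -> expr) (f : tree -> tree) :
  (forall b st, eval st (e b) = f (st b)) ->
  (forall b, eval_time (e b) = eval_time (e 0)) ->
  (forall x, tree_size (f x) <= (tree_size x).+1) -> polytime f.
Proof.
move=> eval_e time_e size_f; split; first by exists S; solve_polynomial.
exists (fun b => Assign b (e b)), (fun=> (eval_time (e 0)).+1).
split=> [|b st]; first by solve_polynomial.
eexists; eexists; split; first exact: ExecAssign.
- by rewrite update_same.
- by move=> x xb; rewrite update_other // ltn_eqF.
- by rewrite time_e.
Qed.

Lemma polytime_id : polytime (fun x => x).
Proof. exact: (@polytime_assign EVar). Qed.

Lemma polytime_nil : polytime (fun=> Nil).
Proof. by apply: (@polytime_assign (fun=> ENil)) => // x; rewrite ltnS. Qed.

Lemma polytime_comp f g :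
  polytime f -> polytime g -> polytime (fun x => f (g x)).
Proof.
move=> [[Sf pSf size_f] [cf [Tf [pTf run_f]]]].
move=> [[Sg pSg size_g] [cg [Tg [pTg run_g]]]]; split.
  exists (fun n => Sf (Sg n)); first exact: is_polynomial_comp.
  by move=> x; rewrite (leq_trans (size_f _)) // is_polynomial_homo.
exists (fun b => Seq (cg b) (cf b)), (fun n => (Tg n + Tf (Sg n)).+1); split.
  by have := is_polynomial_comp pTf pSg; solve_polynomial.
move=> b st; have [k1 [st1 [exec1 res1 frame1 time1]]] := run_g b st.
have [k2 [st2 [exec2 res2 frame2 time2]]] := run_f b st1.
exists (k1 + k2).+1, st2; split; first exact: ExecSeq exec1 exec2.
- by rewrite res2 res1.
- by move=> x xb; rewrite frame2 // frame1.
- by rewrite ltnS leq_add // (leq_trans time2) // is_polynomial_homo // res1.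
Qed.

Lemma polytime_hd f : polytime f -> polytime (fun x => tree_hd (f x)).
Proof.
apply: polytime_comp; apply: (@polytime_assign (fun b => EHd (EVar b))) => // x.
by rewrite leqW // tree_size_hd.
Qed.

Lemma polytime_tl f : polytime f -> polytime (fun x => tree_tl (f x)).
Proof.
apply: polytime_comp; apply: (@polytime_assign (fun b => ETl (EVar b))) => // x.
by rewrite leqW // tree_size_tl.
Qed.

Definition call (c : nat -> cmd) (b d : nat) : cmd :=
  Seq (Assign d (EVar b)) (c d).

Lemma exec_call c f T b d st : computes c f T -> b < d ->
  exists k st', [/\ exec (call c b d) st k st', st' d = f (st b),
    forall x, x < d -> st' x = st x & k <= T (tree_size (st b)) + 3].
Proof.
move=> run_c bd; have [k [st' []]] := run_c d (update st d (st b)).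
rewrite update_same => exec_c res frame time.
eexists; exists st'; split.
- exact: ExecSeq (ExecAssign st d (EVar b)) exec_c.
- exact: res.
- by move=> x xd; rewrite frame // update_other // ltn_eqF.
- by rewrite /=; lia.
Qed.

Lemma polytime_cons f g :
  polytime f -> polytime g -> polytime (fun x => Cons (f x) (g x)).
Proof.
move=> [[Sf pSf size_f] [cf [Tf [pTf run_f]]]].
move=> [[Sg pSg size_g] [cg [Tg [pTg run_g]]]]; split.
  exists (fun n => (Sf n + Sg n).+1) => [|x]; first by solve_polynomial.
  by rewrite ltnS leq_add.
exists (fun b => Seq (call cf b b.+1) (Seq (call cg b b.+2)
  (Assign b (ECons (EVar b.+1) (EVar b.+2))))).
exists (fun n => Tf n + Tg n + 12); split; first by solve_polynomial.
move=> b st.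
have [k1 [st1 [exec1 res1 frame1 time1]]] := exec_call st run_f (ltnSn b).
have [k2 [st2 [exec2 res2 frame2 time2]]] := exec_call st1 run_g (leqnSn b.+1).
rewrite frame1 // in res2 time2.
eexists; eexists; split.
- by apply: ExecSeq exec1 _; apply: ExecSeq exec2 _; apply: ExecAssign.
- by rewrite update_same /= res2 frame2 // res1.
- by move=> x xb; rewrite update_other ?frame2 ?frame1 //; lia.
- by rewrite /=; lia.
Qed.

Lemma exec_if st k st' e c1 c2 :
  exec (if eval st e is Nil then c2 else c1) st k st' ->
  exec (If e c1 c2) st (eval_time e + k).+1 st'.
Proof.
case E: (eval st e) => [|x y]; first exact: ExecIfFalse.
by apply: ExecIfTrue; rewrite E.
Qed.

Definition tree_if (c a b : tree) : tree := if c is Nil then b else a.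

Lemma tree_size_if c a b :
  tree_size (tree_if c a b) <= maxn (tree_size a) (tree_size b).
Proof. by case: c => [|? ?]; rewrite leq_max leqnn ?orbT. Qed.

Lemma polytime_if c f g : polytime c -> polytime f -> polytime g ->
  polytime (fun x => tree_if (c x) (f x) (g x)).
Proof.
move=> [_ [cc [Tc [pTc run_c]]]] [[Sf pSf size_f] [cf [Tf [pTf run_f]]]].
move=> [[Sg pSg size_g] [cg [Tg [pTg run_g]]]]; split.
  exists (fun n => Sf n + Sg n) => [|x]; first by solve_polynomial.
  have := tree_size_if (c x) (f x) (g x).
  by have := size_f x; have := size_g x; lia.
exists (fun b => Seq (call cc b b.+1) (If (EVar b.+1) (cf b) (cg b))).
exists (fun n => Tc n + Tf n + Tg n + 12); split; first by solve_polynomial.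
move=> b st.
have [k1 [st1 [exec1 res1 frame1 time1]]] := exec_call st run_c (ltnSn b).
have st1b : st1 b = st b by rewrite frame1.
have [k2 [st2 [exec2 res2 frame2 time2]]] : exists k st',
    [/\ exec (if st1 b.+1 is Nil then cg b else cf b) st1 k st',
        st' b = tree_if (c (st b)) (f (st b)) (g (st b)),
        forall x, x < b -> st' x = st1 x
      & k <= Tf (tree_size (st b)) + Tg (tree_size (st b))].
  rewrite res1 -st1b; case: (c (st1 b)) => [|u v].
    have [k [st2 [? ? ? time]]] := run_g b st1.
    by exists k, st2; split=> //; rewrite (leq_trans time) // leq_addl.
  have [k [st2 [? ? ? time]]] := run_f b st1.
  by exists k, st2; split=> //; rewrite (leq_trans time) // leq_addr.
eexists; exists st2; split.
- by apply: ExecSeq exec1 _; apply: (@exec_if _ _ _ (EVar b.+1)) exec2.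
- exact: res2.
- by move=> x xb; rewrite frame2 // frame1 // ltnW.
- by rewrite /=; lia.
Qed.

(** * Iteration over lists *)

(* The step function h receives the environment e, the not yet processed part
   of the list (whose head is the current element) and the accumulator. *)
Fixpoint tree_foldl (h : tree -> tree -> tree -> tree) (e acc xs : tree) :
    tree :=
  if xs is Cons _ xs' then tree_foldl h e (h e xs acc) xs' else acc.

Definition uncurry2 (g : tree -> tree -> tree) (z : tree) : tree :=
  g (tree_hd z) (tree_tl z).

Definition uncurry3 (h : tree -> tree -> tree -> tree) (z : tree) : tree :=
  h (tree_hd z) (tree_hd (tree_tl z)) (tree_tl (tree_tl z)).

Definition growth_le (h : tree -> tree -> tree -> tree) (Q : nat -> nat) :
    Prop :=
  forall e xs acc,
    tree_size (h e xs acc) <= tree_size acc + Q (tree_size e + tree_size xs).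

(* Without this condition on its step function, a loop could double the size of
   the accumulator in every iteration. *)
Definition additive_growth (h : tree -> tree -> tree -> tree) : Prop :=
  exists2 Q, is_polynomial Q & growth_le h Q.

Lemma tree_size_foldl h Q e acc xs : is_polynomial Q -> growth_le h Q ->
  tree_size (tree_foldl h e acc xs) <=
    tree_size acc + tree_size xs * Q (tree_size e + tree_size xs).
Proof.
move=> pQ hQ; elim: xs acc => [|a _ xs IH] acc /=; first by rewrite leq_addr.
have le_h := hQ e (Cons a xs) acc; rewrite /= in le_h.
apply: leq_trans (IH _) _; set n := (_ + (_ + _).+1) in le_h *.
have le_Q : Q (tree_size e + tree_size xs) <= Q n.
  by apply: is_polynomial_homo => //; rewrite /n; lia.
have : tree_size xs * Q (tree_size e + tree_size xs) <= tree_size xs * Q n.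
  by rewrite leq_mul2l le_Q orbT.
by rewrite mulSn mulnDl; lia.
Qed.

Lemma additive_growth_acc : additive_growth (fun _ _ acc => acc).
Proof.
by exists (fun=> 0) => [|e xs acc]; [solve_polynomial|rewrite addn0].
Qed.

Lemma additive_growth_env g :
  polytime (uncurry2 g) -> additive_growth (fun e xs _ => g e xs).
Proof.
move=> [[S pS size_g] _]; exists (fun n => S n.+1).
  exact/is_polynomial_comp/is_polynomialS/is_polynomial_id.
by move=> e xs acc; rewrite (leq_trans (size_g (Cons e xs))) // leq_addl.
Qed.

Lemma additive_growth_tl h :
  additive_growth h -> additive_growth (fun e xs acc => tree_tl (h e xs acc)).
Proof.
move=> [Q pQ growth_h]; exists Q => // e xs acc.
exact: leq_trans (tree_size_tl _) (growth_h _ _ _).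
Qed.

Lemma additive_growth_cons g h : polytime (uncurry2 g) -> additive_growth h ->
  additive_growth (fun e xs acc => Cons (g e xs) (h e xs acc)).
Proof.
move=> /additive_growth_env[Qg pQg growth_g] [Q pQ growth_h].
exists (fun n => (Qg n + Q n).+2) => [|e xs acc]; first by solve_polynomial.
by have /= := growth_g e xs Nil; have := growth_h e xs acc; lia.
Qed.

Lemma additive_growth_if c h1 h2 : additive_growth h1 -> additive_growth h2 ->
  additive_growth
    (fun e xs acc => tree_if (c e xs acc) (h1 e xs acc) (h2 e xs acc)).
Proof.
move=> [Q1 pQ1 growth1] [Q2 pQ2 growth2].
exists (fun n => Q1 n + Q2 n) => [|e xs acc]; first by solve_polynomial.
have := tree_size_if (c e xs acc) (h1 e xs acc) (h2 e xs acc).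
by have := growth1 e xs acc; have := growth2 e xs acc; lia.
Qed.

Lemma additive_growth_foldl h f g : additive_growth h ->
  polytime (uncurry2 f) -> polytime (uncurry2 g) ->
  additive_growth (fun e xs acc => tree_foldl h (f e xs) acc (g e xs)).
Proof.
move=> [Q pQ hQ] [[Sf pSf size_f] _] [[Sg pSg size_g] _].
exists (fun n => Sg n.+1 * Q (Sf n.+1 + Sg n.+1)).
  have pS := is_polynomialS is_polynomial_id.
  have pSf' := is_polynomial_comp pSf pS.
  have pSg' := is_polynomial_comp pSg pS.
  exact/is_polynomialM/(is_polynomial_comp pQ)/is_polynomialD.
move=> e xs acc; apply: leq_trans (tree_size_foldl _ _ _ pQ hQ) _.
have /= le_f := size_f (Cons e xs); have /= le_g := size_g (Cons e xs).
by rewrite leq_add2l leq_mul // is_polynomial_homo // leq_add.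
Qed.

Section FoldProgram.
Variables (h : tree -> tree -> tree -> tree).
Variables (c : nat -> cmd) (T Q : nat -> nat).
Hypothesis run_c : computes c (uncurry3 h) T.
Hypotheses (T_poly : is_polynomial T) (Q_poly : is_polynomial Q).
Hypothesis growth_h : growth_le h Q.

(* The accumulator is in variable b, the environment in b + 1 and the rest of
   the list in b + 2. *)
Definition fold_body (b : nat) : cmd :=
  Seq (Assign b.+3 (ECons (EVar b.+1) (ECons (EVar b.+2) (EVar b))))
    (Seq (c b.+3) (Seq (Assign b (EVar b.+3)) (Assign b.+2 (ETl (EVar b.+2))))).

Definition fold_loop (b : nat) : cmd := While (EVar b.+2) (fold_body b).

Definition fold_program (b : nat) : cmd :=
  Seq (Assign b.+1 (EHd (EVar b))) (Seq (Assign b.+2 (ETl (ETl (EVar b))))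
    (Seq (Assign b (EHd (ETl (EVar b)))) (fold_loop b))).

Lemma exec_fold_body b st : exists k st', exec (fold_body b) st k st' /\
  [/\ [/\ st' b = h (st b.+1) (st b.+2) (st b), st' b.+1 = st b.+1
        & st' b.+2 = tree_tl (st b.+2)],
    forall x, x < b -> st' x = st x
    & k <= 16 +
        T (tree_size (st b.+1) + tree_size (st b.+2) + tree_size (st b)).+2].
Proof.
have [k [st' []]] :=
  run_c b.+3 (update st b.+3 (Cons (st b.+1) (Cons (st b.+2) (st b)))).
rewrite update_same => exec_c res frame time.
have keep x : x < b.+3 -> st' x = st x.
  by move=> xb; rewrite frame // update_other // ltn_eqF.
eexists; eexists; split.
  apply: ExecSeq; first exact: ExecAssign.
  apply: ExecSeq; first exact: exec_c.
  by apply: ExecSeq; apply: ExecAssign.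
split; [split| |] => [|||x xb|].
- by rewrite update_other ?update_same /= ?res // ltn_eqF.
- by rewrite !update_other ?keep //; lia.
- by rewrite update_same /= update_other ?keep //; lia.
- by rewrite !update_other ?keep //; lia.
- by rewrite /= addnS addnA in time *; lia.
Qed.

Lemma exec_fold_loop b n M st :
  tree_size (st b.+1) + tree_size (st b.+2) <= n ->
  tree_size (st b) + tree_size (st b.+2) * Q n <= M ->
  exists k st', [/\ exec (fold_loop b) st k st',
    st' b = tree_foldl h (st b.+1) (st b) (st b.+2),
    forall x, x < b -> st' x = st x
    & k <= tree_size (st b.+2) * (T (n + M).+2 + 20)].
Proof.
move list_st: (st b.+2) => xs.
elim: xs st list_st => [|a _ xs IH] st list_st le_n le_M.
  exists 2, st; split=> //; last by rewrite mul1n; lia.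
  exact: (@ExecWhileFalse st (EVar b.+2)).
have [k1 [st1 [exec1 [[acc1 env1 list1] frame1 time1]]]] := exec_fold_body b st.
have le_h := growth_h (st b.+1) (st b.+2) (st b).
have le_Q : Q (tree_size (st b.+1) + tree_size (st b.+2)) <= Q n.
  by rewrite list_st is_polynomial_homo.
rewrite list_st /= in list1 acc1 time1 le_h le_Q le_n le_M.
rewrite mulSn mulnDl in le_M.
have [||k2 [st2 [exec2 res2 frame2 time2]]] := IH st1 list1.
- by rewrite env1; lia.
- by rewrite acc1; lia.
exists (1 + k1 + k2).+1, st2; split.
- by apply: ExecWhileTrue exec1 exec2; rewrite /= list_st.
- by rewrite res2 env1 acc1.
- by move=> x xb; rewrite frame2 // frame1.
- have : k1 <= 16 + T (n + M).+2.
    by apply: leq_trans time1 _; rewrite leq_add2l is_polynomial_homo //; lia.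
  by rewrite /= mulSn; nia.
Qed.

Definition fold_size (n : nat) : nat := n + n * Q (n + n).

Definition fold_time (n : nat) : nat :=
  n * (T (n + n + fold_size n).+2 + 20) + 16.

Lemma is_polynomial_fold_size : is_polynomial fold_size.
Proof.
have p2 : is_polynomial (fun n => n + n) by solve_polynomial.
by have := is_polynomial_comp Q_poly p2; rewrite /fold_size; solve_polynomial.
Qed.

Lemma is_polynomial_fold_time : is_polynomial fold_time.
Proof.
have pS := is_polynomial_fold_size.
have : is_polynomial (fun n => T (n + n + fold_size n).+2).
  by apply: (is_polynomial_comp T_poly); solve_polynomial.
by rewrite /fold_time; solve_polynomial.
Qed.

Lemma tree_size_fold z :
  tree_size (uncurry3 (tree_foldl h) z) <= fold_size (tree_size z).
Proof.
have size_acc := leq_trans (tree_size_hd (tree_tl z)) (tree_size_tl z).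
have size_list := leq_trans (tree_size_tl (tree_tl z)) (tree_size_tl z).
apply: leq_trans (tree_size_foldl _ _ _ Q_poly growth_h) _.
by rewrite leq_add // leq_mul // is_polynomial_homo // leq_add // tree_size_hd.
Qed.

Lemma computes_fold : computes fold_program (uncurry3 (tree_foldl h)) fold_time.
Proof.
move=> b st; set z := st b; set n := tree_size z.
have size_env : tree_size (tree_hd z) <= n := tree_size_hd z.
have size_acc := leq_trans (tree_size_hd (tree_tl z)) (tree_size_tl z).
have size_list := leq_trans (tree_size_tl (tree_tl z)) (tree_size_tl z).
pose st_env := update st b.+1 (tree_hd z).
pose st_list := update st_env b.+2 (tree_tl (tree_tl z)).
pose st1 := update st_list b (tree_hd (tree_tl z)).
have st_envb : st_env b = z by rewrite /st_env update_other // ltn_eqF.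
have st_listb : st_list b = z by rewrite /st_list update_other // ltn_eqF.
have set_list := ExecAssign st_env b.+2 (ETl (ETl (EVar b))).
have set_acc := ExecAssign st_list b (EHd (ETl (EVar b))).
rewrite [eval _ _]/= st_envb in set_list.
rewrite [eval _ _]/= st_listb in set_acc.
have acc1 : st1 b = tree_hd (tree_tl z) by rewrite /st1 update_same.
have env1 : st1 b.+1 = tree_hd z.
  rewrite /st1 update_other /st_list 1?update_other /st_env ?update_same //.
    by lia.
  by lia.
have list1 : st1 b.+2 = tree_tl (tree_tl z).
  by rewrite /st1 update_other /st_list ?update_same //; lia.
have [||k [st' [exec1 res frame time]]] :=
  @exec_fold_loop b (n + n) (fold_size n) st1.
- by rewrite env1 list1 leq_add.
- by rewrite acc1 list1 leq_add // leq_mul.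
rewrite list1 in time.
eexists; exists st'; split.
- exact: ExecSeq (ExecAssign st b.+1 (EHd (EVar b)))
    (ExecSeq set_list (ExecSeq set_acc exec1)).
- by rewrite res acc1 env1 list1.
- by move=> x xb; rewrite frame // /st1 /st_list /st_env !update_other //; lia.
- rewrite /= /fold_time; set t := T _ in time *.
  have : tree_size (tree_tl (tree_tl z)) * (t + 20) <= n * (t + 20).
    by rewrite leq_mul.
  lia.
Qed.

End FoldProgram.

Lemma polytime_foldl h e i l :
  polytime (uncurry3 h) -> additive_growth h ->
  polytime e -> polytime i -> polytime l ->
  polytime (fun x => tree_foldl h (e x) (i x) (l x)).
Proof.
move=> [_ [c [T [pT run_c]]]] [Q pQ growth_h] pe pi pl.
apply: (@polytime_comp (uncurry3 (tree_foldl h))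
  (fun x => Cons (e x) (Cons (i x) (l x)))).
  split; first by exists (fold_size Q) => [|z];
    [apply: is_polynomial_fold_size|apply: tree_size_fold].
  exists (fold_program c), (fold_time T Q).
  by split; [exact: is_polynomial_fold_time|exact: computes_fold].
exact: polytime_cons pe (polytime_cons pi pl).
Qed.

Create HintDb polytime.
#[local] Hint Resolve polytime_nil polytime_id polytime_cons polytime_hd
  polytime_tl polytime_if polytime_foldl additive_growth_acc additive_growth_env
  additive_growth_tl additive_growth_cons additive_growth_if
  additive_growth_foldl : polytime.
#[local] Hint Extern 1 (polytime (uncurry2 _)) => rewrite /uncurry2 : polytime.
#[local] Hint Extern 1 (polytime (uncurry3 _)) => rewrite /uncurry3 : polytime.

Ltac solve_polytime := auto 40 with polytime.

(** * From functions to programs *)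

Fixpoint assigned_bound (c : cmd) : nat :=
  match c with
  | Skip => 0
  | Assign x _ => x.+1
  | Seq c1 c2 | If _ c1 c2 => maxn (assigned_bound c1) (assigned_bound c2)
  | While _ c1 => assigned_bound c1
  end.

Lemma exec_unassigned c st k st' x :
  exec c st k st' -> assigned_bound c <= x -> st' x = st x.
Proof.
elim=> {c st k st'} //=.
- by move=> st y e xy; rewrite update_other // gtn_eqF.
- by move=> > _ IH1 _ IH2; rewrite geq_max => /andP[/IH1<- /IH2].
- by move=> > _ _ IH; rewrite geq_max => /andP[/IH].
- by move=> > _ _ IH; rewrite geq_max => /andP[_ /IH].
- by move=> > _ _ IH1 _ IH2 xc; rewrite IH2 // IH1.
Qed.

Fixpoint clear (n : nat) : cmd :=
  if n is n'.+1 then Seq (Assign n ENil) (clear n') else Skip.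

Lemma exec_clear n st :
  exec (clear n) st (3 * n).+1 (fun x => if 0 < x <= n then Nil else st x).
Proof.
elim: n st => [|n IH] st.
  rewrite (_ : (fun x => _) = st); first exact: ExecSkip.
  by apply: funext => -[].
rewrite (_ : (fun x => _) =
  fun x => if 0 < x <= n then Nil else update st n.+1 Nil x).
  rewrite (_ : (3 * n.+1).+1 = (2 + (3 * n).+1).+1); last by lia.
  exact: ExecSeq (ExecAssign st n.+1 ENil) (IH _).
apply: funext => x; rewrite /update [x <= n.+1]leq_eqVlt ltnS.
by case: eqP => [->|_]; rewrite ?ltnn ?andbF.
Qed.

Lemma init_store0 x : init_store x 0 = x.
Proof. exact: update_same. Qed.

(* A program expects its scratch variables to be [Nil] at the start, so those
   used for f are cleared before p runs. *)
Lemma poly_time_on_comp f (dom dom' : tree -> Prop) p :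
  polytime f -> (forall x, dom x -> dom' (f x)) -> poly_time_on dom' p ->
  exists q, poly_time_on dom q /\
    forall x y, outputs p (f x) y -> outputs q x y.
Proof.
move=> [[S pS size_f] [c [T [pT run_f]]]] dom_f [C [d poly_p]].
pose n := assigned_bound (c 0).
have run x k y : runs_in p (f x) k y -> exists2 k',
    runs_in (Seq (c 0) (Seq (clear n) p)) x k' y &
    k' <= T (tree_size x) + (3 * n + 3 + k).
  move=> [st3 exec_p res_p].
  have [k1 [st1 [exec1 res1 _ time1]]] := run_f 0 (init_store x).
  have st2E : (fun z => if 0 < z <= n then Nil else st1 z) = init_store (f x).
    apply: funext => -[|z] /=; first by rewrite res1 !init_store0.
    by case: leqP => // nz; rewrite (exec_unassigned exec1) // ltnW.
  have exec2 := exec_clear n st1; rewrite st2E in exec2.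
  rewrite init_store0 in time1.
  exists (k1 + ((3 * n).+1 + k).+1).+1; last by lia.
  by exists st3 => //; apply: ExecSeq exec1 (ExecSeq exec2 exec_p).
exists (Seq (c 0) (Seq (clear n) p)); split; last first.
  by move=> x y [k /run[k' ? _]]; exists k'.
have pE : is_polynomial (fun m => C * m ^ d).
  by have := is_polynomialX d is_polynomial_id; solve_polynomial.
have pB : is_polynomial (fun m => T m + (3 * n + 3 + C * S m ^ d)).
  by have := is_polynomial_comp pE pS; solve_polynomial.
have [C' [d' le_B]] := is_polynomial_le_monomial pB.
exists C', d' => x dom_x.
have [k [y [run_p time_p]]] := poly_p _ (dom_f x dom_x).
have [k' run_q time_q] := run x k y run_p; exists k', y; split=> //.
apply: leq_trans time_q _; apply: leq_trans (le_B _ (tree_size_gt0 x)).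
by rewrite !leq_add2l (leq_trans time_p) // (is_polynomial_homo pE).
Qed.

Lemma polytime_program f : polytime f ->
  exists p, (forall dom, poly_time_on dom p) /\ forall x, outputs p x (f x).
Proof.
move=> pf; have skip_out x : runs_in Skip x 1 x.
  by exists (init_store x); [apply: ExecSkip|apply: init_store0].
have [||p [poly_p out_p]] := @poly_time_on_comp f xpredT xpredT Skip pf.
- by [].
- by exists 1, 0 => x _; exists 1, x; rewrite expn0.
exists p; split=> [dom|x]; last by apply: out_p; exists 1.
by have [C [d poly]] := poly_p; exists C, d => x _; apply: poly.
Qed.

(** * The sampling algorithm *)

(* Lists serve as unary numbers: only their lengths matter in [tree_sub],
   [tree_add], [tree_neq] and [tree_min]. *)
Definition tree_sub (a b : tree) : tree :=
  tree_foldl (fun _ _ acc => tree_tl acc) Nil a b.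

Definition tree_add (a b : tree) : tree :=
  tree_foldl (fun _ _ acc => Cons Nil acc) Nil a b.

Definition tree_neq (a b : tree) : tree :=
  tree_if (tree_sub a b) (tree_sub a b) (tree_sub b a).

Definition tree_min (a b : tree) : tree := tree_if (tree_sub a b) b a.

(* The accumulator pairs the unread part of w with the count. *)
Definition tree_mismatches (u w : tree) : tree :=
  tree_tl (tree_foldl (fun _ xs acc => Cons (tree_tl (tree_hd acc))
    (tree_if (tree_neq (tree_hd xs) (tree_hd (tree_hd acc)))
       (Cons Nil (tree_tl acc)) (tree_tl acc))) Nil (Cons w Nil) u).

Definition tree_dist (u s : tree) : tree :=
  tree_foldl (fun e xs acc =>
    tree_if (tree_sub e xs) acc (tree_min acc (tree_mismatches e xs))) u u s.

Definition tree_cost (F u : tree) : tree :=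
  tree_foldl (fun e xs acc => tree_add acc (tree_dist e (tree_hd xs))) u Nil F.

Definition tree_suffixes (F : tree) : tree :=
  tree_foldl (fun _ ss acc =>
    tree_foldl (fun _ xs acc' => Cons xs acc') Nil acc (tree_hd ss)) Nil Nil F.

Definition tree_count (a col : tree) : tree :=
  tree_foldl (fun e xs acc =>
    tree_if (tree_neq e (tree_hd xs)) acc (Cons Nil acc)) a Nil col.

Definition tree_plurality (col : tree) : tree :=
  tree_foldl (fun e xs acc =>
    tree_if (tree_sub (tree_count (tree_hd xs) e) (tree_count acc e))
      (tree_hd xs) acc)
  col (tree_hd col) col.

Definition tree_column (c x : tree) : tree :=
  tree_foldl (fun e xs acc => Cons (tree_hd (tree_sub (tree_hd xs) e)) acc)
    c Nil x.

Definition tree_consensus (c x : tree) : tree :=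
  tree_foldl (fun e xs acc =>
    Cons (tree_plurality (tree_column (tree_tl xs) e)) acc)
    x Nil c.

Definition tree_cheaper (F u v : tree) : tree :=
  tree_if (tree_sub (tree_cost F u) (tree_cost F v)) v u.

(* [ctx] packs the family, the list of its suffixes and a list whose length is
   that of the strings to be produced; [x] is the sample collected so far, which
   is completed by k further suffixes in the best possible way. *)
Fixpoint tree_search (k : nat) (ctx x : tree) : tree :=
  if k is k'.+1 then
    tree_foldl (fun e xs acc => tree_cheaper (tree_hd (tree_hd e)) acc
        (tree_search k' (tree_hd e) (Cons (tree_hd xs) (tree_tl e))))
      (Cons ctx x) (tree_search k' ctx x) (tree_hd (tree_tl ctx))
  else tree_consensus (tree_tl (tree_tl ctx)) x.

(* Length 0 is treated apart because the alphabet can be empty then. *)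
Definition tree_csp (r : nat) (x : tree) : tree :=
  tree_if (tree_tl x)
    (tree_search r
       (Cons (tree_hd x) (Cons (tree_suffixes (tree_hd x)) (tree_tl x))) Nil)
    Nil.

Lemma polytime_sub f g : polytime f -> polytime g ->
  polytime (fun x => tree_sub (f x) (g x)).
Proof. by move=> pf pg; rewrite /tree_sub; solve_polytime. Qed.
#[local] Hint Resolve polytime_sub : polytime.

Lemma polytime_add f g : polytime f -> polytime g ->
  polytime (fun x => tree_add (f x) (g x)).
Proof. by move=> pf pg; rewrite /tree_add; solve_polytime. Qed.
#[local] Hint Resolve polytime_add : polytime.

Lemma polytime_neq f g : polytime f -> polytime g ->
  polytime (fun x => tree_neq (f x) (g x)).
Proof. by move=> pf pg; rewrite /tree_neq; solve_polytime. Qed.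
#[local] Hint Resolve polytime_neq : polytime.

Lemma polytime_mismatches f g : polytime f -> polytime g ->
  polytime (fun x => tree_mismatches (f x) (g x)).
Proof.
move=> pf pg; apply/polytime_tl/polytime_foldl; try by solve_polytime.
exists (fun=> 5) => [|e xs acc]; first by solve_polynomial.
move: (tree_neq _ _) => c /=.
have := tree_size_if c (Cons Nil (tree_tl acc)) (tree_tl acc).
by have := tree_size_tl (tree_hd acc); case: acc => [|a b] /=; lia.
Qed.
#[local] Hint Resolve polytime_mismatches : polytime.

Lemma polytime_dist f g : polytime f -> polytime g ->
  polytime (fun x => tree_dist (f x) (g x)).
Proof. by move=> pf pg; rewrite /tree_dist /tree_min; solve_polytime. Qed.
#[local] Hint Resolve polytime_dist : polytime.

Lemma polytime_cost f g : polytime f -> polytime g ->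
  polytime (fun x => tree_cost (f x) (g x)).
Proof. by move=> pf pg; rewrite /tree_cost /tree_add; solve_polytime. Qed.
#[local] Hint Resolve polytime_cost : polytime.

Lemma polytime_suffixes f : polytime f ->
  polytime (fun x => tree_suffixes (f x)).
Proof. by move=> pf; rewrite /tree_suffixes; solve_polytime. Qed.
#[local] Hint Resolve polytime_suffixes : polytime.

Lemma polytime_count f g : polytime f -> polytime g ->
  polytime (fun x => tree_count (f x) (g x)).
Proof. by move=> pf pg; rewrite /tree_count; solve_polytime. Qed.
#[local] Hint Resolve polytime_count : polytime.

Lemma polytime_plurality f : polytime f ->
  polytime (fun x => tree_plurality (f x)).
Proof. by move=> pf; rewrite /tree_plurality; solve_polytime. Qed.
#[local] Hint Resolve polytime_plurality : polytime.

Lemma polytime_column f g : polytime f -> polytime g ->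
  polytime (fun x => tree_column (f x) (g x)).
Proof. by move=> pf pg; rewrite /tree_column; solve_polytime. Qed.
#[local] Hint Resolve polytime_column : polytime.

Lemma polytime_consensus f g : polytime f -> polytime g ->
  polytime (fun x => tree_consensus (f x) (g x)).
Proof. by move=> pf pg; rewrite /tree_consensus; solve_polytime. Qed.
#[local] Hint Resolve polytime_consensus : polytime.

Lemma polytime_search k f g : polytime f -> polytime g ->
  polytime (fun x => tree_search k (f x) (g x)).
Proof.
elim: k f g => [|k IH] f g pf pg /=; first by solve_polytime.
by apply: polytime_foldl; rewrite /tree_cheaper; solve_polytime.
Qed.
#[local] Hint Resolve polytime_search : polytime.

Lemma polytime_csp r : polytime (tree_csp r).
Proof. by rewrite /tree_csp; solve_polytime. Qed.

(** * The algorithm on encoded strings *)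

Fixpoint tree_len (x : tree) : nat :=
  if x is Cons _ y then (tree_len y).+1 else 0.

Lemma tree_ifE c a b : tree_if c a b = if tree_len c == 0 then b else a.
Proof. by case: c. Qed.

Lemma tree_len_sub a b : tree_len (tree_sub a b) = tree_len a - tree_len b.
Proof.
rewrite /tree_sub; elim: b a => [|? _ b IH] a /=; first by rewrite subn0.
by rewrite IH; case: a => //= ? a; rewrite subSS.
Qed.

Lemma tree_if_sub a b c d :
  tree_if (tree_sub a b) c d = if tree_len a <= tree_len b then d else c.
Proof. by rewrite tree_ifE tree_len_sub subn_eq0. Qed.

Lemma tree_len_add a b : tree_len (tree_add a b) = tree_len a + tree_len b.
Proof.
rewrite /tree_add; elim: b a => [|? _ b IH] a /=; first by rewrite addn0.
by rewrite IH /= addnS.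
Qed.

Lemma tree_if_neq a b c d :
  tree_if (tree_neq a b) c d = if tree_len a == tree_len b then d else c.
Proof.
rewrite tree_ifE /tree_neq tree_if_sub [_ == tree_len b]eqn_leq.
by case: leqP => ab; rewrite tree_len_sub subn_eq0 // leqNgt ab.
Qed.

Lemma tree_len_min a b :
  tree_len (tree_min a b) = minn (tree_len a) (tree_len b).
Proof. by rewrite /tree_min tree_if_sub minnC /minn ltnNge; case: leqP. Qed.

Lemma tree_len_enc_nat n : tree_len (enc_nat n) = n.
Proof. by elim: n => //= n ->. Qed.

Lemma tree_len_enc_seq (T : Type) (enc : T -> tree) s :
  tree_len (enc_seq enc s) = size s.
Proof. by elim: s => //= a s ->. Qed.

Lemma tree_sub_enc_seq (T : Type) (enc : T -> tree) s c :
  tree_sub (enc_seq enc s) c = enc_seq enc (drop (tree_len c) s).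
Proof.
rewrite /tree_sub; elim: c s => [|? _ c IH] s /=; first by rewrite drop0.
by case: s => [|a s] /=; rewrite -?IH //= -[Nil]/(enc_seq enc [::]) IH.
Qed.

Lemma tree_add_enc_nat (T : Type) (enc : T -> tree) n (s : seq T) :
  tree_add (enc_nat n) (enc_seq enc s) = enc_nat (n + size s).
Proof.
rewrite /tree_add; elim: s n => [|a s IH] n /=; first by rewrite addn0.
by rewrite -[Cons Nil _]/(enc_nat n.+1) IH addSnnS.
Qed.

Lemma tree_foldl_enc_seq (T U : Type) (enc : T -> tree) (enc' : U -> tree)
    h e g s z :
  (forall a xs y, h e (Cons (enc a) xs) (enc' y) = enc' (g y a)) ->
  tree_foldl h e (enc' z) (enc_seq enc s) = enc' (foldl g z s).
Proof. by move=> h_enc; elim: s z => //= a s IH z; rewrite h_enc IH. Qed.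

Definition least (T : Type) (le : rel T) (x : T) (s : seq T) : T :=
  foldl (fun y z => if le y z then y else z) x s.

Lemma least_le (T : eqType) (le : rel T) x s y :
  total le -> transitive le -> y \in x :: s -> le (least le x s) y.
Proof.
move=> le_total le_trans.
have le_refl z : le z z by have := le_total z z; rewrite orbb.
rewrite /least; elim: s x y => [|z s IH] x y /=; first by rewrite inE => /eqP->.
set w := if _ then _ else _.
have [wx wz] : le w x /\ le w z.
  by rewrite /w; case: ifP => xz; split=> //; have := le_total x z; rewrite xz.
have le_w := IH w w (mem_head _ _).
rewrite !inE => /or3P[/eqP->|/eqP->|ys].
- exact: le_trans wx.
- exact: le_trans wz.
- by apply: IH; rewrite inE ys orbT.
Qed.

Lemma foldl_map (T U V : Type) (f : V -> U -> V) (g : T -> U) z s :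
  foldl f z (map g s) = foldl (fun y x => f y (g x)) z s.
Proof. by elim: s z => //= x s IH z; rewrite IH. Qed.

Fixpoint suffixes (T : Type) (s : seq T) : seq (seq T) :=
  if s is _ :: s' then s :: suffixes s' else [::].

Lemma mem_suffixes (T : eqType) (s w : seq T) :
  (w \in suffixes s) = (w != [::]) && suffix w s.
Proof.
elim: s w => [|a s IH] w /=; first by rewrite suffixs0 andNb.
rewrite inE IH; have [->|ne] /= := eqVneq w (a :: s).
  by rewrite suffix_refl.
case: w ne => //= b w ne; apply/idP/idP => /suffixP[s'].
  by move=> ->; rewrite -cat_cons suffix_suffix.
case: s' => [|c s'] /=; first by move=> E; rewrite E eqxx in ne.
by case=> _ ->; rewrite suffix_suffix.
Qed.

Section Strings.
Variables (Sigma : finType) (a0 : Sigma).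

Definition mismatches (u w : seq Sigma) : nat :=
  \sum_(j < size u) (nth a0 u j != nth a0 w j).

Lemma mismatches_cons a u w :
  mismatches (a :: u) w = (a != head a0 w) + mismatches u (behead w).
Proof.
rewrite /mismatches big_ord_recl /= nth0; congr addn.
by apply: eq_bigr => j _; rewrite nth_behead.
Qed.

Lemma hamming_mismatches m (u y : m.-tuple Sigma) w :
  prefix y w -> hamming u y = mismatches u w.
Proof.
move=> /prefixP[w' ->]; rewrite /hamming /mismatches -sum1_card size_tuple.
rewrite big_mkcond; apply: eq_bigr => j _.
by rewrite inE nth_cat size_tuple ltn_ord !(tnth_nth a0); case: eqP.
Qed.

Lemma hamming_le m (u y : m.-tuple Sigma) : hamming u y <= m.
Proof. by rewrite -[X in _ <= X]card_ord max_card. Qed.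

Lemma leq_dist_to_substrings m n k (u : m.-tuple Sigma) (s : n.-tuple Sigma) :
  (k <= dist_to_substrings u s) = (k <= m) &&
    all (fun w => (m <= size w) ==> (k <= mismatches u w)) (suffixes s).
Proof.
have geP := bigmin_geP m k (fun y : m.-tuple Sigma => infix y s) (hamming u).
apply: (sameP geP).
apply: (iffP andP) => [[km /allP k_le]|[km k_le]]; split=> //.
  move=> y /infixP[s1 [s2 def_s]]; case: (posnP k) => [->//|k_gt0].
  have pre : prefix y (y ++ s2) by rewrite prefix_prefix.
  rewrite leEnat (hamming_mismatches _ pre).
  have size_w : m <= size (y ++ s2) by rewrite size_cat size_tuple leq_addr.
  apply: (implyP (k_le (y ++ s2) _)) => //.
  rewrite mem_suffixes def_s suffix_suffix andbT -size_eq0 size_cat size_tuple.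
  by rewrite addn_eq0 negb_and -lt0n (leq_trans k_gt0).
apply/allP => w; rewrite mem_suffixes => /andP[_ sw].
apply/implyP => mw; have size_y : size (take m w) == m by rewrite size_takel.
have pre : prefix (Tuple size_y) w by rewrite /= prefix_take.
rewrite -(hamming_mismatches _ pre); apply: k_le.
exact: infix_trans (prefixW pre) (suffixW sw).
Qed.

Lemma dist_to_substrings_le_mismatches m n (u : m.-tuple Sigma)
    (s : n.-tuple Sigma) w :
  w \in suffixes s -> m <= size w -> dist_to_substrings u s <= mismatches u w.
Proof.
move=> sw mw; have := leqnn (dist_to_substrings u s).
by rewrite leq_dist_to_substrings => /andP[_ /allP/(_ w sw)/implyP/(_ mw)].
Qed.

Lemma closest_suffix m n (v : m.-tuple Sigma) (s : n.-tuple Sigma) :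
  0 < m -> m <= n -> exists w, [/\ w \in suffixes s, m <= size w
    & mismatches v w <= dist_to_substrings v s].
Proof.
move=> m_gt0 mn.
have size_y : size (take m s) == m by rewrite size_takel ?size_tuple.
have infix_y : infix (Tuple size_y) s by rewrite /= prefixW ?prefix_take.
have [y infix_y' ->] : exists2 y : m.-tuple Sigma, infix y s &
    dist_to_substrings v s = hamming v y.
  have [y ? ?] := eq_bigmin (x := m) (Tuple size_y)
    (fun y : m.-tuple Sigma => infix y s)
    (hamming v) infix_y (fun y _ => hamming_le v y).
  by exists y.
have [s1 [s2 def_s]] := infixP infix_y'.
have size_w : m <= size (y ++ s2) by rewrite size_cat size_tuple leq_addr.
exists (y ++ s2).
rewrite -(hamming_mismatches v (prefix_prefix y s2)); split=> //.
by rewrite mem_suffixes def_s suffix_suffix andbT -size_eq0 -lt0n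
           (leq_trans m_gt0).
Qed.

Definition plurality (col : seq Sigma) : Sigma :=
  least (relpre (fun a => count_mem a col) geq) (head a0 col) col.

Lemma count_mem_plurality col b :
  count_mem b col <= count_mem (plurality col) col.
Proof.
have [bc|/count_memPn->//] := boolP (b \in col).
apply: (least_le (le := relpre (fun a => count_mem a col) geq)).
- by move=> a c; apply: leq_total.
- by move=> a a' c /= le1 le2; apply: leq_trans le2 le1.
- by rewrite inE bc orbT.
Qed.

(* Reversed, since [tree_column] collects the symbols in an accumulator. *)
Definition column (x : seq (seq Sigma)) (j : nat) : seq Sigma :=
  rev [seq nth a0 w j | w <- x].

Definition consensus m (x : seq (seq Sigma)) : m.-tuple Sigma :=
  [tuple plurality (column x j) | j < m].

Definition family_suffixes (Ss : seq (seq Sigma)) : seq (seq Sigma) :=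
  rev (flatten (map (@suffixes Sigma) Ss)).

Lemma mem_family_suffixes Ss s w :
  s \in Ss -> w \in suffixes s -> w \in family_suffixes Ss.
Proof. by move=> sS ws; rewrite mem_rev; apply/flatten_mapP; exists s. Qed.

Section Search.
Variables (t n m : nat) (Ss : t.-tuple (n.-tuple Sigma)) (W : seq (seq Sigma)).

Fixpoint search (k : nat) (x : seq (seq Sigma)) : m.-tuple Sigma :=
  if k is k'.+1 then
    least (relpre (cost Ss) leq) (search k' x) [seq search k' (w :: x) | w <- W]
  else consensus m x.

Lemma cost_search_le k x w : w \in W ->
  cost Ss (search k.+1 x) <= cost Ss (search k (w :: x)).
Proof.
move=> wW; apply: (least_le (le := relpre (cost Ss) leq)) => [u v|v u w'|].
- exact: leq_total.
- exact: leq_trans.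
- by rewrite inE (map_f (fun w => search k (w :: x)) wW) orbT.
Qed.

End Search.

(* The symbol encoded by [Nil] is the one read beyond the end of a list. *)
Hypothesis a0_rank : enum_rank a0 = 0 :> nat.

Notation enc_sym := (@enc_symbol Sigma).
Notation enc_str := (@enc_string Sigma).
Notation enc_strs := (enc_seq enc_str).

Lemma tree_hd_enc_string w : tree_hd (enc_str w) = enc_sym (head a0 w).
Proof. by case: w => //=; rewrite /enc_symbol a0_rank. Qed.

Lemma tree_tl_enc_string w : tree_tl (enc_str w) = enc_str (behead w).
Proof. by case: w. Qed.

Lemma tree_if_neq_symbol a b c d :
  tree_if (tree_neq (enc_sym a) (enc_sym b)) c d = if a == b then d else c.
Proof.
rewrite tree_if_neq !tree_len_enc_nat; congr (if _ then d else c).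
by apply/eqP/eqP => [/val_inj/enum_rank_inj|->].
Qed.

Lemma tree_len_mismatches u w :
  tree_len (tree_mismatches (enc_str u) (enc_str w)) = mismatches u w.
Proof.
rewrite /tree_mismatches; set h := fun _ _ _ => _.
suff fold_h acc : tree_len (tree_tl (tree_foldl h Nil (Cons (enc_str w) acc)
    (enc_str u))) = mismatches u w + tree_len acc by rewrite fold_h addn0.
elim: u w acc => [|a u IH] w acc; first by rewrite /mismatches big_ord0.
rewrite /= {2}/h /= tree_tl_enc_string tree_hd_enc_string tree_if_neq_symbol IH.
by rewrite mismatches_cons fun_if /=; case: eqP => /=; lia.
Qed.

Lemma tree_len_dist m n (u : m.-tuple Sigma) (s : n.-tuple Sigma) :
  tree_len (tree_dist (enc_str u) (enc_str s)) = dist_to_substrings u s.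
Proof.
rewrite /tree_dist; set h := fun _ _ _ => _.
have leq_fold k (x : seq Sigma) acc :
    (k <= tree_len (tree_foldl h (enc_str u) acc (enc_str x))) =
      (k <= tree_len acc) &&
      all (fun w => (m <= size w) ==> (k <= mismatches u w)) (suffixes x).
  elim: x acc => [|a x IH] acc; first by rewrite andbT.
  rewrite /= IH /= {1}/h -[Cons (enc_sym a) _]/(enc_str (a :: x)) tree_if_sub.
  rewrite !tree_len_enc_seq size_tuple fun_if tree_len_min.
  rewrite tree_len_mismatches andbA.
  by congr (_ && _); case: ifP => _ /=; rewrite ?andbT // leq_min.
have leq_dist k :
    (k <= tree_len (tree_foldl h (enc_str u) (enc_str u) (enc_str s))) =
    (k <= dist_to_substrings u s).
  by rewrite leq_fold leq_dist_to_substrings tree_len_enc_seq size_tuple.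
by apply/eqP; rewrite eqn_leq -leq_dist leqnn leq_dist leqnn.
Qed.

Lemma tree_len_cost t n m (Ss : t.-tuple (n.-tuple Sigma))
    (u : m.-tuple Sigma) :
  tree_len (tree_cost (enc_family Ss) (enc_str u)) = cost Ss u.
Proof.
transitivity (0 + \sum_(s <- Ss) dist_to_substrings u s); last first.
  by rewrite big_tuple.
rewrite /tree_cost /enc_family -[X in X + _]/(tree_len Nil).
elim: (tval Ss) Nil => [|s ss IH] acc /=; first by rewrite big_nil addn0.
by rewrite IH tree_len_add tree_len_dist big_cons addnA.
Qed.

Lemma tree_suffixes_enc t n (Ss : t.-tuple (n.-tuple Sigma)) :
  tree_suffixes (enc_family Ss) = enc_strs (family_suffixes (map val Ss)).
Proof.
have push_suffixes (s : seq Sigma) acc :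
    tree_foldl (fun _ xs acc' => Cons xs acc') Nil (enc_strs acc) (enc_str s) =
    enc_strs (catrev (suffixes s) acc).
  elim: s acc => //= a s IH acc.
  rewrite -[Cons (enc_sym a) _]/(enc_str (a :: s)).
  by rewrite -[Cons _ _]/(enc_strs (_ :: acc)) IH.
rewrite /tree_suffixes /family_suffixes /rev.
rewrite -[X in tree_foldl _ _ X]/(enc_strs [::]).
rewrite /enc_family; elim: (tval Ss) [::] => //= s ss IH acc.
by rewrite catrev_catl -IH push_suffixes.
Qed.

Lemma tree_len_count a col :
  tree_len (tree_count (enc_sym a) (enc_str col)) = count_mem a col.
Proof.
rewrite /tree_count; set h := fun _ _ _ => _.
suff fold_h acc : tree_len (tree_foldl h (enc_sym a) acc (enc_str col)) =
    count_mem a col + tree_len acc by rewrite fold_h addn0.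
elim: col acc => //= b col IH acc.
by rewrite IH /h tree_if_neq_symbol eq_sym; case: eqP => _ /=; lia.
Qed.

Lemma tree_plurality_enc col :
  tree_plurality (enc_str col) = enc_sym (plurality col).
Proof.
rewrite /tree_plurality tree_hd_enc_string.
apply: tree_foldl_enc_seq => a xs b /=.
by rewrite tree_if_sub !tree_len_count; case: ifP.
Qed.

Lemma tree_column_enc c x :
  tree_column c (enc_strs x) = enc_str (column x (tree_len c)).
Proof.
rewrite /tree_column /column /rev -[X in tree_foldl _ _ X]/(enc_str [::]).
elim: x [::] => [|w x IH] acc //=.
by rewrite tree_sub_enc_seq tree_hd_enc_string -nth0 nth_drop addn0
           -[Cons _ _]/(enc_str (_ :: acc)) IH.
Qed.

Lemma tree_consensus_enc c x :
  tree_consensus c (enc_strs x) = enc_str (consensus (tree_len c) x).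
Proof.
have -> : tval (consensus (tree_len c) x) =
    mkseq (fun j => plurality (column x j)) (tree_len c).
  by rewrite /= /mkseq -val_enum_ord -map_comp.
rewrite /tree_consensus -[mkseq _ _]cats0.
rewrite -[X in tree_foldl _ _ X]/(enc_str [::]).
elim: c [::] => [|? _ c IH] acc //.
rewrite [tree_len _]/= mkseqS cat_rcons -IH [LHS]/=.
by rewrite tree_column_enc tree_plurality_enc.
Qed.

Lemma tree_search_enc t n (Ss : t.-tuple (n.-tuple Sigma)) W c k x :
  tree_search k (Cons (enc_family Ss) (Cons (enc_strs W) c)) (enc_strs x) =
    enc_str (search (tree_len c) Ss W k x).
Proof.
elim: k x => [|k IH] x; first by rewrite /= tree_consensus_enc.
rewrite /= IH /least foldl_map.
apply: (@tree_foldl_enc_seq _ _ enc_str (fun u : _.-tuple Sigma => enc_str u)).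
move=> w xs u /=.
rewrite -[Cons (enc_str w) _]/(enc_strs (w :: x)) IH /tree_cheaper tree_if_sub.
by rewrite !tree_len_cost; case: ifP.
Qed.

Lemma tree_csp_enc t n m (Ss : t.-tuple (n.-tuple Sigma)) r : 0 < m ->
  tree_csp r (csp_input Ss m) =
    enc_str (search m Ss (family_suffixes (map val Ss)) r [::]).
Proof.
case: m => // m _; rewrite /tree_csp /= tree_suffixes_enc.
have := tree_search_enc Ss (family_suffixes (map val Ss)) (enc_nat m.+1) r [::].
by rewrite tree_len_enc_nat.
Qed.

End Strings.

(** * Quality of the sampled consensus *)

Local Open Scope ring_scope.

Section Expectation.
Variables (R : realFieldType) (I : finType).
Hypothesis I_gt0 : (0 < #|I|)%N.

Definition mean (f : I -> R) : R := #|I|%:R^-1 * \sum_i f i.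

(* k independent uniform draws, prepended to those in x. *)
Fixpoint expect (k : nat) (f : seq I -> R) (x : seq I) : R :=
  if k is k'.+1 then mean (fun i => expect k' f (i :: x)) else f x.

Let card_neq0 : #|I|%:R != 0 :> R.
Proof. by rewrite pnatr_eq0 -lt0n. Qed.

Lemma eq_mean f g : f =1 g -> mean f = mean g.
Proof. by move=> fg; rewrite /mean (eq_bigr g). Qed.

Lemma mean_le f g : (forall i, f i <= g i) -> mean f <= mean g.
Proof. by move=> fg; rewrite ler_wpM2l ?invr_ge0 // ler_sum. Qed.

Lemma meanD f g : mean (fun i => f i + g i) = mean f + mean g.
Proof. by rewrite /mean big_split mulrDr. Qed.

Lemma meanZ a f : mean (fun i => a * f i) = a * mean f.
Proof. by rewrite /mean -mulr_sumr mulrCA. Qed.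

Lemma mean_const a : mean (fun=> a) = a.
Proof. by rewrite /mean sumr_const -[a *+ _]mulr_natl mulKf. Qed.

Lemma card_mul_mean f : #|I|%:R * mean f = \sum_i f i.
Proof. by rewrite mulVKf. Qed.

Lemma eq_expect k f g x : f =1 g -> expect k f x = expect k g x.
Proof. by move=> fg; elim: k x => //= k IH x; apply: eq_mean. Qed.

Lemma expect_le k f g x :
  (forall y, size y = (k + size x)%N -> f y <= g y) ->
  expect k f x <= expect k g x.
Proof.
elim: k x => [|k IH] x fg /=; first exact: fg.
by apply: mean_le => i; apply: IH => y sy; apply: fg; rewrite sy addnS.
Qed.

Lemma expectD k f g x :
  expect k (fun y => f y + g y) x = expect k f x + expect k g x.
Proof. by elim: k x => //= k IH x; rewrite -meanD; apply: eq_mean. Qed.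

Lemma expectZ k a f x : expect k (fun y => a * f y) x = a * expect k f x.
Proof. by elim: k x => //= k IH x; rewrite -meanZ; apply: eq_mean. Qed.

Lemma expect_const k a x : expect k (fun=> a) x = a.
Proof.
by elim: k x => //= k IH x; rewrite -[RHS]mean_const; apply: eq_mean.
Qed.

Lemma expect_sum (J : finType) k (f : J -> seq I -> R) x :
  expect k (fun y => \sum_a f a y) x = \sum_a expect k (f a) x.
Proof.
elim: k x => //= k IH x; rewrite (eq_mean (fun i => IH _)) /mean.
by rewrite exchange_big mulr_sumr.
Qed.

Lemma expect_sqr_sum k (Z : I -> R) x : mean Z = 0 ->
  expect k (fun y => (\sum_(i <- y) Z i) ^+ 2) x =
    (\sum_(i <- x) Z i) ^+ 2 + k%:R * mean (fun i => Z i ^+ 2).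
Proof.
move=> Z0; elim: k x => [|k IH] x /=; first by rewrite mul0r addr0.
rewrite (eq_mean (fun i => IH _)) meanD mean_const.
set S := \sum_(i <- x) Z i; set V := mean (fun i => Z i ^+ 2).
have -> : mean (fun i => (\sum_(j <- i :: x) Z j) ^+ 2) = S ^+ 2 + V.
  rewrite (@eq_mean _ (fun i => Z i ^+ 2 + ((2 * S) * Z i + S ^+ 2))).
    by rewrite !meanD meanZ Z0 mean_const mulr0 add0r addrC.
  by move=> i; rewrite big_cons -/S; ring.
by rewrite -natr1; ring.
Qed.

Section Column.
Variables (Sigma : finType) (c : I -> Sigma).

Definition freq (a : Sigma) : R := mean (fun i => (c i == a)%:R).

Lemma freq_ge0 a : 0 <= freq a.
Proof. by rewrite -[X in X <= _](mean_const 0); apply: mean_le => i. Qed.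

Lemma freq_le1 a : freq a <= 1.
Proof.
rewrite -[leRHS](mean_const 1); apply: mean_le => i.
by rewrite lern1 leq_b1.
Qed.

Lemma freqD_le1 a b : a != b -> freq a + freq b <= 1.
Proof.
move=> ab; rewrite -[X in _ <= X](mean_const 1) -meanD; apply: mean_le => i.
rewrite -natrD lern1.
by case: (c i =P a) => [->|_]; rewrite ?(negbTE ab) ?leq_b1.
Qed.

Lemma card_mul_freqC a : #|I|%:R * (1 - freq a) = \sum_i (a != c i)%:R.
Proof.
rewrite mulrBr mulr1 /freq card_mul_mean -sumr_const -sumrB.
by apply: eq_bigr => i _; rewrite eq_sym; case: eqP => _; rewrite ?subrr ?subr0.
Qed.

Definition excess (a b : Sigma) (i : I) : R :=
  (c i == a)%:R - (c i == b)%:R - (freq a - freq b).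

Lemma mean_excess a b : mean (excess a b) = 0.
Proof.
rewrite /excess meanD mean_const meanD.
rewrite (@eq_mean (fun i => - (c i == b)%:R) (fun i => (-1) * (c i == b)%:R)).
  by rewrite meanZ -/(freq a) -/(freq b); ring.
by move=> i; rewrite mulN1r.
Qed.

Lemma mean_excess_sqr a b :
  mean (fun i => excess a b i ^+ 2) <= 4 * (1 - freq b).
Proof.
have [->|ab] := eqVneq a b.
  rewrite (@eq_mean _ (fun=> 0)) => [|i]; last by rewrite /excess !subrr expr0n.
  by rewrite mean_const mulr_ge0 // subr_ge0 freq_le1.
set d := freq a - freq b.
have -> : mean (fun i => excess a b i ^+ 2) = freq a + freq b - d ^+ 2.
  rewrite (@eq_mean _ (fun i => (1 - 2 * d) * (c i == a)%:R +
    ((1 + 2 * d) * (c i == b)%:R + d ^+ 2))).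
    by rewrite !meanD !meanZ mean_const -/(freq a) -/(freq b) /d; ring.
  move=> i; rewrite /excess -/d; case: (c i =P a) => [->|_].
    by rewrite (negbTE ab) /=; ring.
  by case: eqP => _ /=; ring.
have := freqD_le1 ab; have := freq_ge0 a; have := freq_ge0 b.
by rewrite /d; move: (freq a) (freq b) => p q; nra.
Qed.

Lemma sum_excess a b x : \sum_(i <- x) excess a b i =
  (count_mem a (map c x))%:R - (count_mem b (map c x))%:R
    - (size x)%:R * (freq a - freq b).
Proof.
elim: x => [|i x IH]; first by rewrite big_nil /=; ring.
by rewrite big_cons IH /= /excess !natrD -natr1; ring.
Qed.

Variables (A : seq I -> Sigma) (b : Sigma) (s : nat).
Hypothesis A_plurality : forall x a,
  (count_mem a (map c x) <= count_mem (A x) (map c x))%N.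
Hypothesis s_gt1 : (1 < s)%N.

Let r : R := (s ^ 2)%:R.
Let q : R := 1 - freq b.
Let deviation (a : Sigma) (x : seq I) : R := (\sum_(i <- x) excess a b i) / r.

Let s_gt0 : 0 < s%:R :> R.
Proof. by rewrite ltr0n ltnW. Qed.

Let rE : r = s%:R ^+ 2.
Proof. by rewrite /r natrX. Qed.

Let r_gt0 : 0 < r.
Proof. by rewrite rE exprn_gt0. Qed.

Let q_ge0 : 0 <= q.
Proof. by rewrite subr_ge0 freq_le1. Qed.

Lemma expect_deviation_sqr a :
  expect (s ^ 2) (fun x => deviation a x ^+ 2) [::] <= 4 * q / r.
Proof.
have -> : expect (s ^ 2) (fun x => deviation a x ^+ 2) [::] =
    expect (s ^ 2)
      (fun x => (r ^+ 2)^-1 * (\sum_(i <- x) excess a b i) ^+ 2) [::].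
  by apply: eq_expect => x; rewrite expr_div_n mulrC.
rewrite expectZ (expect_sqr_sum _ _ (mean_excess a b)) big_nil expr0n add0r -/r.
rewrite [leLHS](_ : _ = mean (fun i => excess a b i ^+ 2) / r).
  by rewrite ler_pM2r ?invr_gt0 // mean_excess_sqr.
by field; rewrite gt_eqF.
Qed.

Lemma freq_gap_le_deviation x : size x = (s ^ 2)%N ->
  freq b - freq (A x) <= deviation (A x) x.
Proof.
move=> sx; rewrite ler_pdivlMr // sum_excess sx -/r.
have : (count_mem b (map c x))%:R <= (count_mem (A x) (map c x))%:R :> R.
  by rewrite ler_nat A_plurality.
by move: (_%:R) (_%:R) => N M NM; lra.
Qed.

(* The gap is at most the deviation y.  For q >= 1/4 AM-GM is used,
   y <= 1 / (2 s) + (s / 2) y ^ 2.  For q < 1/4 every symbol other than b is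
   behind b by at least 1/2, so that y >= 1/2 and y <= 2 y ^ 2. *)
Lemma freq_gap_quadratic : exists u v : R,
  [/\ 0 <= u, 0 <= v, u + v * (4 * q / r) <= 4 * q / s%:R
    & forall x, size x = (s ^ 2)%N ->
        freq b - freq (A x) <= u + v * deviation (A x) x ^+ 2].
Proof.
have s_ge2 : 2 <= s%:R :> R by rewrite ler_nat.
set w := s%:R^-1; have w_gt0 : 0 < w by rewrite invr_gt0.
have sw : s%:R * w = 1 by rewrite divff ?gt_eqF.
have sww : s%:R * w ^+ 2 = w by rewrite expr2 mulrA sw mul1r.
have rw : r^-1 = w ^+ 2 by rewrite rE exprVn.
have [q_large|q_small] := leP 4^-1 q.
  exists (w / 2), (s%:R / 2); split; first by rewrite divr_ge0 // ltW.
  - by rewrite divr_ge0 // ltW.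
  - rewrite rw (_ : s%:R / 2 * _ = 2 * q * (s%:R * w ^+ 2)); last by field.
    rewrite sww.
    have : 0 <= (q - 4^-1) * w by rewrite mulr_ge0 ?subr_ge0 // ltW.
    by nra.
  - move=> x /freq_gap_le_deviation gap; apply: le_trans gap _.
    set y := deviation _ _; rewrite -subr_ge0.
    rewrite (_ : _ - y = s%:R / 2 * (y - w) ^+ 2).
      by rewrite mulr_ge0 ?sqr_ge0 // divr_ge0 // ltW.
    rewrite (_ : _ * (y - w) ^+ 2 =
      s%:R / 2 * y ^+ 2 - (s%:R * w) * y + (s%:R * w ^+ 2) / 2); last by field.
    by rewrite sw sww; ring.
exists 0, 2; split=> // [|x /freq_gap_le_deviation gap].
  rewrite add0r rw; have : 2 * w <= 1 by rewrite -[leRHS]sw ler_pM2r.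
  have : 0 <= q * w by rewrite mulr_ge0 // ltW.
  by nra.
have [eq_b|neq_b] := eqVneq (A x) b.
  by rewrite eq_b subrr add0r mulr_ge0 ?sqr_ge0.
have : 2^-1 <= freq b - freq (A x).
  by have := freqD_le1 neq_b; move: q_small; rewrite /q; lra.
by move: gap; move: (deviation _ _) (freq b - _) => y d; nra.
Qed.

Lemma expect_plurality_cost :
  expect (s ^ 2) (fun x => 1 - freq (A x)) [::] <=
    (1 + 4 * #|Sigma|%:R / s%:R) * (1 - freq b).
Proof.
have [u [v [u_ge0 v_ge0 uv_le gap_le]]] := freq_gap_quadratic.
apply: (@le_trans _ _
    (expect (s ^ 2) (fun x => q + \sum_a (u + v * deviation a x ^+ 2)) [::])).
  apply: expect_le => x; rewrite addn0 => /gap_le gap.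
  have -> : 1 - freq (A x) = q + (freq b - freq (A x)) by rewrite /q; ring.
  rewrite lerD2l (le_trans gap) // (bigD1 (A x)) //= lerDl sumr_ge0 // => a _.
  by rewrite addr_ge0 // mulr_ge0 // sqr_ge0.
rewrite expectD expect_const expect_sum mulrDl mul1r lerD2l.
rewrite (_ : _ * (1 - freq b) = \sum_(a : Sigma) 4 * q / s%:R); last first.
  by rewrite sumr_const -[_ *+ _]mulr_natl /q; ring.
apply: ler_sum => a _; rewrite expectD expect_const expectZ.
by apply: le_trans uv_le; rewrite lerD2l ler_wpM2l // expect_deviation_sqr.
Qed.

End Column.
End Expectation.

Section Approximation.
Variables (R : realFieldType) (Sigma : finType) (a0 : Sigma) (m : nat).

Section Family.
Variables (I : finType) (w : I -> seq Sigma).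
Hypothesis I_gt0 : (0 < #|I|)%N.

Definition total_mismatches (u : seq Sigma) : nat :=
  \sum_i mismatches a0 u (w i).

Lemma total_mismatches_freq (u : m.-tuple Sigma) :
  (total_mismatches u)%:R =
    #|I|%:R * \sum_(j < m) (1 - freq R (fun i => nth a0 (w i) j) (tnth u j)).
Proof.
rewrite mulr_sumr; under [RHS]eq_bigr => j _ do rewrite card_mul_freqC //.
rewrite [RHS]exchange_big natr_sum; apply: eq_bigr => i _.
rewrite /mismatches natr_sum size_tuple; apply: eq_bigr => j _.
by rewrite (tnth_nth a0).
Qed.

Lemma expect_total_mismatches_consensus s (v : m.-tuple Sigma) : (1 < s)%N ->
  expect (s ^ 2)
    (fun x => (total_mismatches (consensus a0 m (map w x)))%:R) [::] <=
    (1 + 4 * #|Sigma|%:R / s%:R) * (total_mismatches v)%:R :> R.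
Proof.
move=> s_gt1; pose c (j : 'I_m) i := nth a0 (w i) j.
pose A (j : 'I_m) x := plurality a0 (column a0 (map w x) j).
have A_plurality j x a :
    (count_mem a (map (c j) x) <= count_mem (A j x) (map (c j) x))%N.
  have := count_mem_plurality a0 (column a0 (map w x) j) a.
  by rewrite -/(A j x) /column !count_rev -map_comp.
apply: (@le_trans _ _ (expect (s ^ 2)
    (fun x => #|I|%:R * \sum_j (1 - freq R (c j) (A j x))) [::])).
  apply: expect_le => x _.
  rewrite total_mismatches_freq ler_wpM2l // ler_sum // => j _.
  by rewrite tnth_mktuple.
rewrite expectZ expect_sum total_mismatches_freq mulrCA ler_wpM2l // mulr_sumr.
by apply: ler_sum => j _; apply: expect_plurality_cost.
Qed.

Lemma search_le_expect t n (Ss : t.-tuple (n.-tuple Sigma))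
    (W : seq (seq Sigma)) k x :
  (forall i, w i \in W) ->
  (cost Ss (search a0 m Ss W k (map w x)))%:R <=
    expect k (fun y => (cost Ss (consensus a0 m (map w y)))%:R) x :> R.
Proof.
move=> wW; elim: k x => [|k IH] x; first exact: lexx.
rewrite -[leLHS](mean_const I_gt0); apply: mean_le => i.
by apply: le_trans (IH (i :: x)); rewrite ler_nat cost_search_le.
Qed.

End Family.

Lemma cost_search_ratio t n (Ss : t.-tuple (n.-tuple Sigma))
    (W : seq (seq Sigma)) s (v : m.-tuple Sigma) :
  (0 < t)%N -> (0 < m)%N -> (m <= n)%N -> (1 < s)%N ->
  (forall i w, w \in suffixes (tnth Ss i) -> w \in W) ->
  (cost Ss (search a0 m Ss W (s ^ 2) [::]))%:R <=
    (1 + 4 * #|Sigma|%:R / s%:R) * (cost Ss v)%:R :> R.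
Proof.
move=> t_gt0 m_gt0 mn s_gt1 suffixes_W.
have /fin_all_exists[w closest_w] i := closest_suffix a0 v (tnth Ss i) m_gt0 mn.
have I_gt0 : (0 < #|'I_t|)%N by rewrite card_ord.
have wW i : w i \in W by have [/suffixes_W] := closest_w i.
apply: le_trans (search_le_expect I_gt0 Ss _ [::] wW) _.
apply: (@le_trans _ _ (expect (s ^ 2)
    (fun x => (total_mismatches w (consensus a0 m (map w x)))%:R) [::])).
  apply: expect_le => x _; rewrite ler_nat leq_sum // => i _.
  by have [? ? _] := closest_w i; apply: dist_to_substrings_le_mismatches.
apply: le_trans (expect_total_mismatches_consensus w I_gt0 v s_gt1) _.
rewrite ler_wpM2l ?addr_ge0 ?divr_ge0 ?mulr_ge0 // ler_nat leq_sum // => i _.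
by have [] := closest_w i.
Qed.

End Approximation.

Lemma csp_ptas (R : realType) (Sigma : finType) (alpha : R) :
  0 < alpha -> exists p, csp_approx_algorithm Sigma (1 + alpha) p.
Proof.
move=> alpha_gt0; pose s := (Num.bound (4 * #|Sigma|%:R / alpha)).+2.
have s_large : 4 * #|Sigma|%:R / s%:R <= alpha.
  rewrite ler_pdivrMr ?ltr0n // [alpha * _]mulrC -ler_pdivrMr //.
  have ge0 : 0 <= 4 * #|Sigma|%:R / alpha by rewrite divr_ge0 ?mulr_ge0 // ltW.
  by apply: le_trans (ltW (archi_boundP ge0)) _; rewrite ler_nat ltnW.
have [p [poly_p out_p]] := polytime_program (polytime_csp (s ^ 2)).
exists p; split=> // t n m Ss t_gt0 mn; have out := out_p (csp_input Ss m).
case: (posnP m) => [m0|m_gt0].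
  subst m; exists [tuple]; split=> // v _.
  by rewrite [v]tuple0 ler_peMl // lerDl ltW.
have n_gt0 : (0 < n)%N := leq_trans m_gt0 mn.
have Sigma_gt0 : (0 < #|Sigma|)%N.
  by apply/card_gt0P; exists (tnth (tnth Ss (Ordinal t_gt0)) (Ordinal n_gt0)).
pose a0 := enum_val (Ordinal Sigma_gt0).
have a0_rank : enum_rank a0 = 0%N :> nat by rewrite enum_valK.
exists (search a0 m Ss (family_suffixes (map val Ss)) (s ^ 2) [::]); split.
  by rewrite -tree_csp_enc.
move=> v _.
apply: le_trans (cost_search_ratio R a0 v t_gt0 m_gt0 mn _ _) _ => //.
- by move=> i w; apply: mem_family_suffixes; apply/map_f/mem_tnth.
- by rewrite ler_wpM2r // lerD2l.
Qed.

(** * Reoptimization *)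

Definition reopt_to_csp (x : tree) : tree :=
  Cons (tree_hd x) (tree_add (enc_nat 1) (tree_tl x)).

Lemma polytime_reopt_to_csp : polytime reopt_to_csp.
Proof.
apply: polytime_cons (polytime_hd polytime_id) (polytime_add _ _).
  exact: polytime_cons polytime_nil polytime_nil.
exact: polytime_tl polytime_id.
Qed.

Lemma reopt_to_csp_enc (Sigma : finType) (t n l : nat)
    (Ss : t.-tuple (n.-tuple Sigma)) (v : l.-tuple Sigma) :
  reopt_to_csp (reopt_input Ss v) = csp_input Ss l.+1.
Proof. by rewrite /reopt_to_csp tree_add_enc_nat size_tuple. Qed.

Lemma reopt_from_csp (R : realType) (Sigma : finType) (rho : R) (p : cmd) :
  csp_approx_algorithm Sigma rho p ->
  exists q, poly_time_on (@is_reopt_input Sigma) q /\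
    forall (t n l : nat) (Ss : t.-tuple (n.-tuple Sigma))
        (vopt : l.-tuple Sigma),
      (0 < t)%N -> (l.+1 <= n)%N ->
      exists v : (l.+1).-tuple Sigma,
        outputs q (reopt_input Ss vopt) (enc_string v) /\
        forall w : (l.+1).-tuple Sigma, optimal_closest_substring Ss w ->
          (cost Ss v)%:R <= rho * (cost Ss w)%:R.
Proof.
move=> [poly_p approx_p].
have [|q [poly_q out_q]] := @poly_time_on_comp _ (@is_reopt_input Sigma)
    (@is_csp_input Sigma) p polytime_reopt_to_csp _ poly_p.
  move=> _ [t [n [l [Ss [vopt [t_gt0 ln _ ->]]]]]].
  by exists t, n, l.+1, Ss; rewrite reopt_to_csp_enc.
exists q; split=> // t n l Ss vopt t_gt0 ln.
have [v [out_v cost_v]] := approx_p t n l.+1 Ss t_gt0 ln.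
by exists v; split=> //; apply: out_q; rewrite reopt_to_csp_enc.
Qed.

Theorem theorem3p2 (R : realType) (Sigma : finType) (sigma : R)
    (hsigma : 1 <= sigma) :
  (exists p : cmd, csp_approx_algorithm Sigma sigma p) ->
  exists q : cmd,
    poly_time_on (@is_reopt_input Sigma) q /\
    forall (t n l : nat) (Ss : t.-tuple (n.-tuple Sigma))
        (vopt : l.-tuple Sigma),
      (0 < t)%N -> (l.+1 <= n)%N -> optimal_closest_substring Ss vopt ->
      exists v'sol : (l.+1).-tuple Sigma,
        outputs q (reopt_input Ss vopt) (enc_string v'sol) /\
        forall v'opt : (l.+1).-tuple Sigma,
          optimal_closest_substring Ss v'opt ->
          (cost Ss v'sol)%:R <=
            (2 * sigma - 1) / sigma * (cost Ss v'opt)%:R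
            + (sigma - 1) / sigma * (t%:R - 1).
Proof.
move=> sigma_approx; have sigma_gt0 : 0 < sigma := lt_le_trans ltr01 hsigma.
have ratioE : (2 * sigma - 1) / sigma = 1 + (sigma - 1) / sigma.
  by field; rewrite gt_eqF.
have [p csp_p] :
    exists p, csp_approx_algorithm Sigma (1 + (sigma - 1) / sigma) p.
  move: hsigma; rewrite le_eqVlt => /predU1P[sigma1|sigma_gt1].
    by rewrite -sigma1 subrr mul0r addr0 sigma1.
  by apply: csp_ptas; rewrite divr_gt0 // subr_gt0.
have [q [poly_q approx_q]] := reopt_from_csp csp_p.
exists q; split=> // t n l Ss vopt t_gt0 ln _.
have [v [out_v cost_v]] := approx_q t n l Ss vopt t_gt0 ln.
exists v; split=> // w /cost_v le_w; rewrite ratioE; apply: le_trans le_w _.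
by rewrite lerDl mulr_ge0 ?divr_ge0 ?subr_ge0 ?ler1n // ltW.
Qed.
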